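(* Let $f:\{-1,1\}^n\to\{-1,1\}$ be a linear threshold function and $g:\{-1,1\}^n\to[-1,1]$ be any bounded function. If $d_{\mathrm{Chow}}(f,g)\le\epsilon$ then $\mathrm{dist}(f,g)\le 2^{-\Omega(\sqrt[3]{\log(1/\epsilon)})}$.
   Context: A linear threshold function is a function of the form $f(x)=\mathrm{sign}(\sum_{i=1}^n w_ix_i-\theta)$ with real $w_i,\theta$, $\mathrm{sign}(z)=1$ if $z\ge 0$ and $-1$ otherwise. For $h:\{-1,1\}^n\to\mathbb{R}$, the Chow vector is $\vec{\chi}_h=(\hat h(0),\dots,\hat h(n))$ with $\hat h(0)=\mathbb{E}[h(x)]$, $\hat h(i)=\mathbb{E}[h(x)x_i]$ (uniform $x$). $d_{\mathrm{Chow}}(f,g)=\|\vec{\chi}_f-\vec{\chi}_g\|_2$ and $\mathrm{dist}(f,g)=\mathbb{E}[|f(x)-g(x)|]$. *)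

(* Defs.v *)
From HB Require Import structures.
From mathcomp Require Import all_boot all_order all_algebra.
From mathcomp Require Import all_classical all_reals all_analysis.
Set Implicit Arguments. Unset Strict Implicit. Unset Printing Implicit Defensive.
Import Order.TTheory GRing.Theory Num.Theory.
Local Open Scope ring_scope.

(* The Boolean cube {-1,1}^n: a point is a finite function 'I_n -> bool,
   with true encoding +1 and false encoding -1. *)
Definition cube (n : nat) := {ffun 'I_n -> bool}.

Definition xr {R : realType} {n : nat} (x : cube n) (i : 'I_n) : R :=
  if x i then 1 else -1.

Definition Ex {R : realType} {n : nat} (h : cube n -> R) : R :=
  (\sum_(x : cube n) h x) / (2 ^+ n).

Definition sgn {R : realType} (z : R) : R := if 0 <= z then 1 else -1.

Definition is_LTF {R : realType} {n : nat} (f : cube n -> R) : Prop :=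
  exists (w : 'I_n -> R) (theta : R),
    forall x, f x = sgn (\sum_(i < n) w i * xr x i - theta).

Definition chow0 {R : realType} {n : nat} (h : cube n -> R) : R := Ex h.
Definition chowi {R : realType} {n : nat} (h : cube n -> R) (i : 'I_n) : R :=
  Ex (fun x => h x * xr x i).

Definition d_Chow {R : realType} {n : nat} (f g : cube n -> R) : R :=
  Num.sqrt ((chow0 f - chow0 g) ^+ 2 + \sum_(i < n) (chowi f i - chowi g i) ^+ 2).

Definition dist {R : realType} {n : nat} (f g : cube n -> R) : R :=
  Ex (fun x => `|f x - g x|).

(* Main.v *)
Require Import Defs.
From HB Require Import structures.
From mathcomp Require Import all_boot all_order all_algebra.
From mathcomp Require Import all_fingroup.
From mathcomp Require Import all_classical all_reals all_analysis.
From mathcomp Require Import ring lra zify.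
Import Order.TTheory GRing.Theory Num.Theory.
Local Open Scope ring_scope.

(** By duality it is enough to find an affine form [l] of coefficient norm at most
    [2 ^ O(q ^ 3)] whose hinge loss [E (1 - f l)^+] is [O(q 2 ^ - q)]: writing
    [u = f - g], one has [E |u| = E u f <= E u l + 2 E (1 - f l)^+], and [E u l] is at
    most the norm of [l] times the Chow distance.

    The form is built by recursion on sets [X] of points of the cube on which a set [D] of
    coordinates is determined linearly by the others; such an [X] has density at most
    [2 ^ - #|D|], so the recursion stops after [q] steps. In one step, take a unit form [w]
    avoiding [D] with [f w > 0] on [X], and let [N] be the points of [X] with [|w| <= b],
    where [b = 2 ^ - O(q ^ 2)]. If [N] is sparse, [w / b] will do. If not, then by small-ball
    anticoncentration [w] has only [2 ^ O(q)] coefficients above [b] and the others have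
    norm [2 ^ O(q) b]. On all but a tiny part of [N] (exponential moments) the large
    coefficients then nearly cancel. Density forces each of them to be, up to [O(b)], a
    combination with coefficients in [{-1, 0, 1}] of only [q + 1] of them, and Cramer's
    rule in dimension [q + 1] shows that they would all be too small for a unit form unless
    some exact linear relation holds on those points of [N]. That relation determines one
    more coordinate; the recursive form [v'] is combined with [w] into [v' + K w]. *)

(** * Linear forms on the cube *)

Definition dotp {R : realType} {n : nat} (w : 'I_n -> R) (x : cube n) : R :=
  \sum_(i < n) w i * xr x i.

Definition flip {n : nat} (i : 'I_n) (x : cube n) : cube n :=
  [ffun j => if j == i then ~~ x j else x j].

Lemma flipK {n : nat} (i : 'I_n) : involutive (flip i).
Proof.
move=> x; apply/ffunP => j; rewrite !ffunE.
by case: eqP => // _; rewrite negbK.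
Qed.

Lemma xr_flip {R : realType} {n : nat} (i j : 'I_n) (x : cube n) :
  xr (flip i x) j = (if j == i then - xr x j else xr x j) :> R.
Proof.
rewrite /xr /flip ffunE; case: eqP => // _.
by case: (x j) => //=; rewrite opprK.
Qed.

Lemma xr_sq {R : realType} {n : nat} (x : cube n) (i : 'I_n) :
  xr x i * xr x i = 1 :> R.
Proof. by rewrite /xr; case: (x i); rewrite ?mulrNN mulr1. Qed.

Lemma dotp_flip {R : realType} {n : nat} (w : 'I_n -> R) i x :
  dotp w (flip i x) = dotp w x - 2 * (w i * xr x i).
Proof.
rewrite /dotp (bigD1 i) //= [in RHS](bigD1 i) //= xr_flip eqxx.
rewrite (eq_bigr (fun j => w j * xr x j)).
  by lra.
by move=> j ji; rewrite xr_flip (negbTE ji).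
Qed.

Lemma sum_flip {R : realType} {n : nat} (i : 'I_n) (F : cube n -> R) :
  \sum_x F x = \sum_x F (flip i x).
Proof. by rewrite (reindex_inj (inv_inj (flipK i))). Qed.

Lemma card_cube n : #|{: cube n}| = (2 ^ n)%N.
Proof. by rewrite card_ffun card_bool card_ord. Qed.

(** Parseval in degree one: distinct coordinates are orthogonal, since flipping [i] negates
    [xr x i * xr x j]. *)
Lemma sum_dotp_sq {R : realType} {n : nat} (w : 'I_n -> R) :
  \sum_(x : cube n) dotp w x ^+ 2 = (\sum_i w i ^+ 2) * 2 ^+ n.
Proof.
have orth i j : i != j -> \sum_(x : cube n) xr x i * xr x j = 0 :> R.
  move=> ij; have := sum_flip i (fun x : cube n => xr x i * xr x j : R).
  under [in X in _ = X -> _]eq_bigr => x _.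
    rewrite !xr_flip eqxx eq_sym (negbTE ij) mulNr; over.
  by rewrite sumrN => /= h; lra.
transitivity (\sum_i \sum_j \sum_(x : cube n) w i * w j * (xr x i * xr x j)).
  under eq_bigr => x _.
    rewrite expr2 /dotp mulr_suml.
    under eq_bigr => i _ do rewrite mulr_sumr.
    over.
  rewrite exchange_big /=; apply: eq_bigr => i _.
  rewrite exchange_big /=; apply: eq_bigr => j _.
  by apply: eq_bigr => x _; ring.
rewrite mulr_suml; apply: eq_bigr => i _.
rewrite (bigD1 i) //= [X in _ + X]big1 ?addr0 => [|j ji].
  under eq_bigr => x _ do rewrite xr_sq mulr1.
  by rewrite sumr_const card_cube -[LHS]mulr_natr natrX expr2.
by rewrite -mulr_sumr orth ?mulr0 // eq_sym.
Qed.

(** * Small-ball anticoncentration *)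

Definition clamp {R : realType} (a z : R) : R := Num.max (- a) (Num.min z a).

Lemma clampP {R : realType} (a z : R) : 0 <= a ->
  [\/ z <= - a /\ clamp a z = - a, - a <= z <= a /\ clamp a z = z
    | a <= z /\ clamp a z = a].
Proof.
move=> a0; rewrite /clamp.
case: (leP z a) => [za|az].
  by case: leP => h; [constructor 1|constructor 2; rewrite ltW].
by constructor 3; rewrite max_r ?(ltW az) //; lra.
Qed.

Lemma clamp_bound {R : realType} (a z : R) : 0 <= a -> `|clamp a z| <= a.
Proof.
move=> a0; rewrite ler_norml.
by case: (clampP _ z a0) => -[h ->]; apply/andP; split; lra.
Qed.

Lemma clamp_sq {R : realType} (a z : R) : 0 <= a ->
  clamp a z ^+ 2 = Num.min `|z| a ^+ 2.
Proof.
move=> a0; have [za|az] := leP `|z| a.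
  rewrite real_normK ?num_real //; move: za; rewrite ler_norml => /andP[h1 h2].
  by case: (clampP _ z a0) => -[h ->] //; congr (_ ^+ 2); lra.
have {}az : z < - a \/ a < z.
  by move: az; rewrite ltNge ler_norml negb_and -!ltNge => /orP.
by case: (clampP _ z a0) => -[h ->]; rewrite ?sqrrN //; case: az; lra.
Qed.

(** Clamping is monotone, so the difference has the sign of [z]. *)
Lemma clamp_crossing_ge0 {R : realType} (a b s z : R) : 0 <= a -> 0 <= b ->
  0 <= clamp a z * (clamp b s - clamp b (s - 2 * z)).
Proof.
move=> a0 b0.
case: (clampP _ z a0) => -[h ->]; case: (clampP _ s b0) => -[h' ->];
case: (clampP _ (s - 2 * z) b0) => -[h'' ->]; nra.
Qed.

(** The level [3 * a] leaves enough room: for [|z| <= a] the point [s - 2 * z] is not clamped and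
    the difference is exactly [2 * z]; for larger [|z|] it still has the sign of [z] and size at
    least [2 * a]. *)
Lemma clamp_crossing {R : realType} (a s z : R) : 0 < a -> `|s| <= a ->
  2 * clamp a z ^+ 2 <= clamp a z * (clamp (3 * a) s - clamp (3 * a) (s - 2 * z)).
Proof.
move=> a0; rewrite ler_norml => /andP[s1 s2].
have a1 : 0 <= a by lra.
have a3 : 0 <= 3 * a by lra.
rewrite expr2.
case: (clampP _ z a1) => -[h ->]; case: (clampP _ s a3) => -[h' ->];
case: (clampP _ (s - 2 * z) a3) => -[h'' ->]; nra.
Qed.

(** Summation by parts on the cube: averaging over [x] and [flip i x], where coordinate [i] changes
    sign, turns a correlation into differences along edges. *)
Lemma sum_dotpr {R : realType} {n : nat} (F : cube n -> R) (v : 'I_n -> R) :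
  \sum_x F x * dotp v x =
  2^-1 * \sum_x \sum_i v i * xr x i * (F x - F (flip i x)).
Proof.
have -> : \sum_x F x * dotp v x = \sum_i \sum_x v i * xr x i * F x.
  rewrite exchange_big /=; apply: eq_bigr => x _.
  by rewrite /dotp mulr_sumr; apply: eq_bigr => i _; rewrite mulrC.
rewrite [in RHS]exchange_big /= mulr_sumr; apply: eq_bigr => i _.
have := sum_flip i (fun x => v i * xr x i * F x); set A := \sum_x _ => h.
have -> : \sum_x v i * xr x i * (F x - F (flip i x)) = A + A.
  rewrite {2}h -big_split /=; apply: eq_bigr => x _.
  by rewrite xr_flip eqxx; ring.
by lra.
Qed.

Lemma sum_const_set {R : realType} {n : nat} (A : {set cube n}) (c : R) :
  \sum_(x in A) c = #|A|%:R * c.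
Proof. by rewrite sumr_const mulr_natl. Qed.

(* Correlate [clamp (3 * a) (dotp w x)] with the form [v] of coefficients [clamp a (w i)]:
   the clamping at [3 * a] caps the correlation at [3 * a] times the norm of [v], while by
   [sum_dotpr] a point with [|dotp w x| <= a] contributes [v i ^+ 2] through the edge of the
   cube in direction [i]. *)
Lemma small_ball {R : realType} {n : nat} (w : 'I_n -> R) (a d : R)
    (A : {set cube n}) : 0 < a -> 0 < d ->
  d * 2 ^+ n <= #|A|%:R -> (forall x, x \in A -> `|dotp w x| <= a) ->
  \sum_i Num.min `|w i| a ^+ 2 <= 9 * a ^+ 2 / d ^+ 2.
Proof.
move=> a0 d0 dA Aw.
have a1 : 0 <= a by lra.
have a3 : 0 <= 3 * a by lra.
pose v i := clamp a (w i); pose psi x := clamp (3 * a) (dotp w x).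
under eq_bigr => i _ do rewrite -clamp_sq // -/(v i).
set V := \sum_i _.
have V0 : 0 <= V by apply: sumr_ge0 => i _; exact: sqr_ge0.
have lower : #|A|%:R * V <= \sum_x psi x * dotp v x.
  rewrite sum_dotpr.
  have E x i : v i * xr x i * (psi x - psi (flip i x)) =
    clamp a (w i * xr x i) * (clamp (3 * a) (dotp w x) -
      clamp (3 * a) (dotp w x - 2 * (w i * xr x i))).
    rewrite /psi dotp_flip; congr (_ * _); rewrite /v /xr.
    case: (x i); rewrite ?mulr1 // ?mulrN1.
    by case: (clampP _ (w i) a1) => -[h ->]; case: (clampP _ (- w i) a1) => -[h' ->]; lra.
  have sqE x i : clamp a (w i * xr x i) ^+ 2 = v i ^+ 2.
    rewrite /v !clamp_sq // normrM /xr; case: (x i);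
    by rewrite ?normrN normr1 mulr1.
  apply: (@le_trans _ _ (2^-1 * \sum_(x in A) (2 * V))).
    by rewrite sum_const_set; lra.
  rewrite ler_pM2l ?invr_gt0 //.
  rewrite big_mkcond /=; apply: ler_sum => x _.
  under [leRHS]eq_bigr => i _ do rewrite E.
  case: ifPn => [xA|_]; last by apply: sumr_ge0 => i _; exact: clamp_crossing_ge0.
  rewrite /V mulr_sumr; apply: ler_sum => i _.
  by rewrite -(sqE x); apply: clamp_crossing => //; exact: Aw.
have upper : \sum_x psi x * dotp v x <=
    (d / 2 * V + 9 * a ^+ 2 / (2 * d)) * 2 ^+ n.
  have -> : (d / 2 * V + 9 * a ^+ 2 / (2 * d)) * 2 ^+ n =
    \sum_(x : cube n) (d / 2 * dotp v x ^+ 2 + 9 * a ^+ 2 / (2 * d)).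
    rewrite big_split /= -mulr_sumr sum_dotp_sq sumr_const card_cube.
    by rewrite -[X in _ = _ + X]mulr_natl natrX -/V; ring.
  apply: ler_sum => x _.
  have p1 : `|psi x| <= 3 * a by apply: clamp_bound.
  (* AM-GM weighted by [d]: the quadratic part sums to [d / 2 * V * 2 ^+ n], half of the lower
     bound, and can be absorbed. *)
  apply: (@le_trans _ _ (d / 2 * dotp v x ^+ 2 + psi x ^+ 2 / (2 * d))).
    rewrite -subr_ge0.
    have -> : d / 2 * dotp v x ^+ 2 + psi x ^+ 2 / (2 * d) - psi x * dotp v x =
      (d * dotp v x - psi x) ^+ 2 / (2 * d) by field; lra.
    by rewrite divr_ge0 ?sqr_ge0 //; lra.
  rewrite lerD2l ler_pM2r ?invr_gt0; last by lra.
  by move: p1; rewrite ler_norml => /andP[]; nra.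
have n0 : 0 < 2 ^+ n :> R by rewrite exprn_gt0.
have : d * V * 2 ^+ n <= (d / 2 * V + 9 * a ^+ 2 / (2 * d)) * 2 ^+ n.
  apply: le_trans upper; apply: le_trans lower.
  by rewrite -mulrA (mulrC V) mulrA ler_wpM2r.
rewrite ler_pM2r // => h.
rewrite ler_pdivlMr ?exprn_gt0 //.
have {h} : 2 * d * (d * V) <= 2 * d * (d / 2 * V + 9 * a ^+ 2 / (2 * d)).
  by rewrite ler_pM2l //; lra.
have -> : 2 * d * (d / 2 * V + 9 * a ^+ 2 / (2 * d)) = d ^+ 2 * V + 9 * a ^+ 2.
  by field; lra.
by nra.
Qed.

(** * Exponential moments *)

(** From [1 - z <= expR (- z)], each exponential is at most [(1 - z)^-1]; the two bounds add up to
    [2 / (1 - u ^+ 2)]. *)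
Lemma expR_cosh_le {R : realType} (u : R) : u ^+ 2 <= 4^-1 ->
  expR u + expR (- u) <= 2 * expR (2 * u ^+ 2).
Proof.
move=> u4.
have [u1 u2] : -1 < u /\ u < 1 by split; nra.
have half (z : R) : z < 1 -> expR z <= (1 - z)^-1.
  move=> z1; rewrite -[expR z]invrK -expRN lef_pV2 ?posrE ?expR_gt0 ?subr_gt0 //.
  exact: expR_ge1Dx.
have := half u u2; have := half (- u) ltac:(lra); rewrite opprK => h1 h2.
apply: (@le_trans _ _ (2 * (1 + 2 * u ^+ 2))).
  apply: le_trans (lerD h2 h1) _.
  have -> : (1 - u)^-1 + (1 + u)^-1 = 2 / (1 - u ^+ 2).
    by field; rewrite !gt_eqF //; nra.
  by rewrite ler_pdivrMr; nra.
by rewrite ler_pM2l // expR_ge1Dx.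
Qed.

Lemma sum_expR_dotp {R : realType} {n : nat} (u : 'I_n -> R) :
  \sum_x expR (dotp u x) = \prod_i (expR (u i) + expR (- u i)).
Proof.
transitivity (\prod_i \sum_(b : bool) expR (u i * (if b then 1 else -1))).
  rewrite bigA_distr_bigA /=; apply: eq_bigr => x _.
  by rewrite /dotp expR_sum.
by apply: eq_bigr => i _; rewrite big_bool /= mulr1 mulrN1.
Qed.

(** The rescaled form [u] has squared norm at most 1/4, so by independence [u] and [- u] both have
    mean exponential at most [expR (2^-1) <= 2]. The absolute value costs the sum of the two. *)
Lemma exp_moment {R : realType} {n : nat} (v : 'I_n -> R) (M : R) : 0 < M ->
  \sum_i v i ^+ 2 <= M ^+ 2 ->
  \sum_x expR (`|dotp v x| / (2 * M)) <= 4 * 2 ^+ n.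
Proof.
move=> M0 vM.
pose u i := v i / (2 * M).
have u2 : \sum_i u i ^+ 2 <= 4^-1.
  rewrite /u; under eq_bigr => i _ do rewrite exprMn.
  rewrite -mulr_suml exprVn ler_pdivrMr; last by nra.
  by apply: le_trans vM _; nra.
have ui i : u i ^+ 2 <= 4^-1.
  apply: le_trans u2; rewrite (bigD1 i) //= lerDl.
  by apply: sumr_ge0 => j _; exact: sqr_ge0.
have uE x : dotp u x = dotp v x / (2 * M).
  by rewrite /dotp mulr_suml; apply: eq_bigr => i _; rewrite /u mulrAC.
have NuE x : dotp (fun i => - u i) x = - dotp u x.
  by rewrite /dotp -sumrN; apply: eq_bigr => i _; rewrite mulNr.
have bnd (s : 'I_n -> R) : (forall i, s i ^+ 2 = u i ^+ 2) ->
    \sum_x expR (dotp s x) <= 2 * 2 ^+ n.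
  move=> su; rewrite sum_expR_dotp.
  apply: (@le_trans _ _ (\prod_(i < n) (2 * expR (2 * u i ^+ 2)))).
    apply: ler_prod => i _; rewrite addr_ge0 ?expR_ge0 //= -su.
    by apply: expR_cosh_le; rewrite su.
  rewrite big_split /= prodr_const card_ord -expR_sum -mulr_sumr mulrC.
  rewrite ler_pM2r ?exprn_gt0 //.
  apply: (@le_trans _ _ (expR (2^-1))); first by rewrite ler_expR; lra.
  rewrite -[expR _]invrK -expRN.
  rewrite -[leRHS]invrK lef_pV2 ?posrE ?expR_gt0 ?invr_gt0 //.
  by apply: le_trans (expR_ge1Dx _); lra.
apply: (@le_trans _ _ (\sum_x (expR (dotp u x) + expR (dotp (fun i => - u i) x)))).
  apply: ler_sum => x _; rewrite NuE.
  have -> : `|dotp v x| / (2 * M) = `|dotp u x|.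
    by rewrite uE normrM normfV (gtr0_norm (_ : 0 < 2 * M)) //; lra.
  by case: (ger0P (dotp u x)) => _; rewrite ?lerDl ?lerDr expR_ge0.
rewrite big_split /=.
have := bnd u (fun=> erefl); have := bnd (fun i => - u i) (fun=> sqrrN _).
by lra.
Qed.

Lemma exp_tail {R : realType} {n : nat} (v : 'I_n -> R) (M t : R)
    (A : {set cube n}) : 0 < M -> \sum_i v i ^+ 2 <= M ^+ 2 ->
  (forall x, x \in A -> t <= `|dotp v x| / (2 * M)) ->
  #|A|%:R <= 4 * expR (- t) * 2 ^+ n.
Proof.
move=> M0 vM At.
have : #|A|%:R * expR t <= 4 * 2 ^+ n.
  apply: le_trans (exp_moment v M M0 vM).
  rewrite -sum_const_set big_mkcond /=; apply: ler_sum => x _.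
  by case: ifPn => [/At xA|_]; rewrite ?ler_expR ?expR_ge0.
rewrite -ler_pdivlMr ?expR_gt0 // expRN => /le_trans; apply.
by rewrite mulrAC.
Qed.

(** * Dense sets of points close to a hyperplane *)

(** Resetting the coordinates in [D] to [false] is injective on [X], with at most [2 ^ (n - #|D|)]
    images. *)
Lemma card_agree {n : nat} (X : {set cube n}) (D : {set 'I_n}) :
  (forall x y, x \in X -> y \in X -> (forall i, i \notin D -> x i = y i) -> x = y) ->
  (#|X| * 2 ^ #|D| <= 2 ^ n)%N.
Proof.
move=> inj.
pose p (x : cube n) : cube n := [ffun i => if i \in D then false else x i].
have pinj : {in X &, injective p}.
  move=> x y xX yX /ffunP pxy; apply: inj => // i iD.
  by have := pxy i; rewrite !ffunE (negbTE iD).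
have : (#|X| <= 2 ^ (n - #|D|))%N.
  rewrite -(card_in_imset pinj).
  have -> : (2 ^ (n - #|D|) = #|pffun_on false (~: D) (predT : pred bool)|)%N.
    by rewrite card_pffun_on [#|~: D|]cardsCs finset.setCK !card_ord card_bool.
  apply/subset_leq_card/fintype.subsetP => _ /imsetP[x _ ->].
  apply/pffun_onP; split=> [|//].
  by apply/fintype.subsetP => i; rewrite !inE ffunE; case: (i \in D).
move=> h; have Dn : (#|D| <= n)%N by rewrite -[n in (_ <= n)%N]card_ord max_card.
by rewrite -[n in leqRHS](subnK Dn) expnD leq_pmul2r // expn_gt0.
Qed.

Lemma norm_det_le {R : realType} {k : nat} (A : 'M[R]_k) (h : R) :
  (forall i j, `|A i j| <= h) -> `|\det A| <= k`!%:R * h ^+ k.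
Proof.
move=> Ah; apply: le_trans (ler_norm_sum _ _ _) _.
apply: (@le_trans _ _ (\sum_(s : 'S_k) h ^+ k)).
  apply: ler_sum => s _; rewrite normrM normrX normrN1 expr1n mul1r normr_prod.
  apply: (@le_trans _ _ (\prod_(i < k) h)); last by rewrite prodr_const card_ord.
  by apply: ler_prod => i _; rewrite normr_ge0 Ah.
by rewrite sumr_const card_Sn mulr_natl.
Qed.

(** With full column rank, [d] independent rows form a square integer matrix. Its determinant is a
    nonzero integer, hence at least 1 in absolute value, so Cramer's rule bounds [w] without any
    loss from the division. *)
Lemma int_kernel_or_small {R : realType} {m d : nat} (B : 'M[int]_(m, d))
    (w : 'cV[R]_d) (h eta : R) : 1 <= h ->
  (forall i j, `|(B i j)%:~R| <= h) ->
  (forall i, `|(map_mx intr B *m w) i 0| <= eta) ->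
  (exists2 c : 'cV[R]_d, c != 0 & map_mx intr B *m c = 0) \/
  (forall j, `|w j 0| <= d%:R * d`!%:R * h ^+ d * eta).
Proof.
move=> h1 Bh Bw; set BR : 'M[R]_(m, d) := map_mx intr B.
have [full|nfull] := boolP (row_full BR); last first.
  left; have : kermx BR^T != 0.
    rewrite kermx_eq0 /row_free mxrank_tr.
    by apply: contra nfull => /eqP ?; apply/eqP.
  case/rowV0Pn => u uK u0; exists u^T.
    by apply: contra u0 => /eqP uT; rewrite -[u]trmxK uT trmx0.
  by apply: trmx_inj; rewrite trmx_mul trmxK trmx0; exact/sub_kermxP.
right=> j.
pose f := fullrankfun full.
pose A0 := rowsub f B; pose A : 'M[R]_d := map_mx intr A0.
have AE : A = rowsub f BR by rewrite /A /A0 /BR map_mxsub.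
have Ah i k : `|A i k| <= h by rewrite /A !mxE.
have detA : 1 <= `|\det A|.
  have : \det A != 0.
    have := fullrowsub_unit full; rewrite -/f -AE unitmxE unitfE //.
  rewrite /A det_map_mx intr_eq0 => d0.
  by rewrite -intr_norm ler1z -gtz0_ge1 normr_gt0.
have d0 : (0 < d)%N by case: (d) j => [[]|].
have eta0 : 0 <= eta by apply: le_trans (Bw (f j)); exact: normr_ge0.
have cof i k : `|cofactor A i k| <= d`!%:R * h ^+ d.
  rewrite /cofactor normrM normrX normrN1 expr1n mul1r.
  apply: (@le_trans _ _ (d.-1`!%:R * h ^+ d.-1)).
    by apply: norm_det_le => i' j'; rewrite !mxE.
  apply: ler_pM; rewrite ?ler0n ?exprn_ge0 ?ler_nat ?leq_fact ?leq_pred //.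
    by lra.
  by rewrite ler_weXn2l // leq_pred.
have wE : \det A * w j 0 = \sum_k cofactor A k j * (BR *m w) (f k) 0.
  have : \adj A *m (A *m w) = \det A *: w.
    by rewrite mulmxA mul_adj_mx mul_scalar_mx.
  move=> /matrixP/(_ j 0); rewrite !mxE => <-; apply: eq_bigr => k _.
  rewrite !mxE; congr (_ * _).
  by apply: eq_bigr => l _; rewrite /A /A0 /BR !mxE.
have : `|\det A * w j 0| <= d%:R * d`!%:R * h ^+ d * eta.
  rewrite wE; apply: le_trans (ler_norm_sum _ _ _) _.
  apply: (@le_trans _ _ (\sum_(k < d) (d`!%:R * h ^+ d * eta))).
    by apply: ler_sum => k _; rewrite normrM ler_pM.
  by rewrite sumr_const card_ord -[leLHS]mulr_natl !mulrA.
by apply: le_trans; rewrite normrM ler_peMl.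
Qed.

(** An integral copy of [xr], so that determinants built from points of the cube are integers. *)
Definition zsign (b : bool) : int := if b then 1 else -1.

Lemma zsignE {R : realType} {n : nat} (x : cube n) i : (zsign (x i))%:~R = xr x i :> R.
Proof. by rewrite /zsign /xr; case: (x i). Qed.

Lemma xr_inj {R : realType} {n : nat} (x y : cube n) i :
  xr x i = xr y i :> R -> x i = y i.
Proof. by rewrite /xr; case: (x i); case: (y i) => // ?; lra. Qed.

Definition agree_off {n : nat} (H D : {set 'I_n}) (x y : cube n) :=
  [forall (i | i \in H :\: D), x i == y i].

(* [D] is a maximal set of coordinates that points of [N] are free to forget. Density makes
   it small; maximality gives, for each other [j], two points of [N] that differ inside [H]
   only at [j] and on [D], and subtracting them isolates [w j]. *)
Lemma combination_of_few {R : realType} {n : nat} (w : 'I_n -> R) (H : {set 'I_n})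
    (N : {set cube n}) (b : R) :
  0 <= b -> (forall x, x \in N -> `|\sum_(i in H) w i * xr x i| <= b) ->
  exists (D : {set 'I_n}) (A : 'I_n -> 'I_n -> int),
    [/\ D \subset H, (#|N| * 2 ^ #|D| <= 2 ^ n)%N,
      forall j, j \in H -> (forall d, `|A j d| <= 1) /\
        `|w j - \sum_(d in D) (A j d)%:~R * w d| <= b
    & forall j, j \in D -> forall d, A j d = (d == j)%:R].
Proof.
move=> b0 Nb.
pose P (D : {set 'I_n}) := (D \subset H) &&
  [forall x in N, forall y in N, agree_off H D x y ==> agree_off H finset.set0 x y].
have P0 : P finset.set0.
  rewrite /P finset.sub0set /=.
  by apply/forall_inP => x _; apply/forall_inP => y _; apply/implyP.
case: (@arg_maxnP _ finset.set0 P (fun D => #|D|) P0) => D /andP[DH /forall_inP DP] Dmax.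
have DE x y : x \in N -> y \in N -> (forall i, i \in H -> i \notin D -> x i = y i) ->
    forall i, i \in H -> x i = y i.
  move=> xN yN xy i iH; have /forall_inP/(_ y yN)/implyP := DP x xN.
  have -> : agree_off H D x y.
    by apply/forall_inP => k /finset.setDP[kH kD]; apply/eqP/xy.
  by move=> /(_ isT)/forall_inP/(_ i); rewrite finset.setD0 => /(_ iH)/eqP.
have row j : exists a : 'I_n -> int, [/\ j \in H -> forall d, `|a d| <= 1,
    j \in H -> `|w j - \sum_(d in D) (a d)%:~R * w d| <= b
    & j \in D -> forall d, a d = (d == j)%:R].
  have [jD|jD] := boolP (j \in D).
    (* The rows indexed by [D] form an identity block, which later shows that a form built from [A]
       is nonzero. *)
    exists (fun d => (d == j)%:R); split=> // _; first by move=> d; case: eqP.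
    rewrite (bigD1 j) //= eqxx mul1r big1 ?addr0 ?subrr ?normr0 //.
    by move=> d /andP[_ /negbTE ->]; rewrite mul0r.
  have [jH|jH] := boolP (j \in H); last by exists (fun=> 0); split.
  have : ~~ P (j |: D).
    apply/negP => /Dmax; rewrite /= cardsU1 jD /= add1n.
    by rewrite ltnn.
  rewrite /P finset.subUset finset.sub1set jH DH /=.
  case/forall_inPn => x xN /forall_inPn[y yN]; rewrite negb_imply => /andP[/forall_inP xy].
  move=> nxy.
  have xyE i : i \in H -> i \notin D -> i != j -> x i = y i.
    move=> iH iD ij; apply/eqP/xy; rewrite !inE iH andbT negb_or ij //.
  have xyj : x j != y j.
    apply: contra nxy => /eqP xyj; apply/forall_inP => i; rewrite finset.setD0 => iH.
    apply/eqP; apply: (DE x y) => // k kH kD.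
    by have [->//|kj] := eqVneq k j; exact: xyE.
  (* Where [x] and [y] agree, [d] drops out of the difference of the two sums; where they differ it
     contributes [2 * xr x d * w d]. A sign is its own inverse, so dividing by [2 * xr x j] leaves a
     coefficient in [{-1, 0, 1}]. *)
  pose a d : int := if x d == y d then 0 else - zsign (x j) * zsign (x d).
  exists a; split=> // _.
    by move=> d; rewrite /a; case: eqP => //; rewrite /zsign; case: (x j); case: (x d).
  have s0 : \sum_(i in H) w i * xr x i - \sum_(i in H) w i * xr y i =
     2 * xr x j * (w j - \sum_(d in D) (a d)%:~R * w d).
    rewrite -sumrB (bigID (mem D)) /= [X in _ + X](bigD1 j) /=; last by rewrite jH.
    rewrite [X in _ + (_ + X)]big1 ?addr0; last first.
      by move=> i /andP[/andP[iH iD] ij]; rewrite /xr xyE // subrr.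
    have -> : xr y j = - xr x j :> R.
      by move: xyj; rewrite /xr; case: (x j); case: (y j); rewrite ?opprK.
    rewrite mulrBr mulr_sumr addrC; congr (_ + _); first by ring.
    rewrite -sumrN (eq_bigl (mem D)) /=; last first.
      by move=> i; apply: andb_idl; exact/fintype.subsetP.
    apply: eq_bigr => d dD; rewrite /a.
    case: (x d =P y d) => [xyd|xyd]; first by rewrite /xr xyd subrr mulr0z mul0r mulr0 oppr0.
    rewrite rmorphM rmorphN /= !zsignE.
    have -> : xr y d = - xr x d :> R.
      by move: xyd; rewrite /xr; case: (x d); case: (y d) => //; rewrite ?opprK.
    have := xr_sq (R := R) x j => h.
    transitivity (2 * w d * xr x d * 1); first by ring.
    by rewrite -h; ring.
  have := le_trans (ler_normB _ _) (lerD (Nb x xN) (Nb y yN)).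
  rewrite s0 !normrM.
  have -> : `|xr x j| = 1 :> R by rewrite /xr; case: (x j); rewrite ?normrN normr1.
  by rewrite ger0_norm //; lra.
have /choice[A AP] := row.
exists D, A; split=> //.
- apply: card_agree => x y xN yN xy; apply/ffunP => i.
  have [iD|iD] := boolP (i \in D); last exact: xy.
  by apply: (DE x y) => //; [move=> k _; exact: xy|exact: (fintype.subsetP DH)].
- by move=> j jH; have [? ? _] := AP j; split; auto.
- by move=> j jD; have [_ _] := AP j; exact.
Qed.

(** The integer matrix [B] evaluates the columns of [A] at the points of [N], and it nearly
    annihilates the restriction of [w] to [D]. A kernel vector [c] yields the form [A c], which
    vanishes on [N]; otherwise the coefficients in [D] are small, and then so are their
    combinations. *)
Lemma vanishing_form_or_small {R : realType} {n : nat} (w : 'I_n -> R) (H : {set 'I_n})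
    (N : {set cube n}) (b h : R) (r : nat) :
  0 <= b -> 1 <= h -> #|H|%:R <= h -> (2 ^ n < #|N| * 2 ^ r.+1)%N ->
  (forall x, x \in N -> `|\sum_(i in H) w i * xr x i| <= b) ->
  (exists v : 'I_n -> R, [/\ exists j, v j != 0, forall i, i \notin H -> v i = 0
     & forall x, x \in N -> dotp v x = 0]) \/
  (forall j, j \in H ->
    `|w j| <= r%:R * (r%:R * r`!%:R * h ^+ r * (b + h * b)) + b).
Proof.
move=> b0 h1 Hh Nr Nb.
have [D [A [DH ND AH AD]]] := combination_of_few w H N b b0 Nb.
have dr : (#|D| <= r)%N.
  rewrite leqNgt; apply: contraTN Nr => rD.
  rewrite -leqNgt; apply: leq_trans ND.
  by rewrite leq_mul // leq_pexp2l.
pose B : 'M[int]_(#|N|, #|D|) :=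
  \matrix_(k, l) \sum_(i in H) A i (enum_val l) * zsign ((enum_val k : cube n) i).
pose wD : 'cV[R]_#|D| := \col_l w (enum_val l).
have BE k l : (B k l)%:~R = \sum_(i in H) (A i (enum_val l))%:~R * xr (enum_val k) i :> R.
  rewrite !mxE rmorph_sum /=; apply: eq_bigr => i _.
  by rewrite rmorphM /= zsignE.
have xr1 x i : `|xr x i| = 1 :> R by move=> *; rewrite /xr; case: (x i); rewrite ?normrN normr1.
have Bh k l : `|(B k l)%:~R| <= h :> R.
  rewrite BE; apply: le_trans (ler_norm_sum _ _ _) _.
  apply: le_trans Hh; rewrite -sumr_const; apply: ler_sum => i iH.
  rewrite normrM xr1 mulr1 -intr_norm -[leRHS]/(1%:~R) ler_int.
  by have [] := AH i iH.
(* The first [b] is the size of the form on [N]; [h * b] collects an approximation error [b] for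
   each element of [H]. *)
have Bw k : `|(map_mx intr B *m wD) k 0| <= b + h * b.
  have -> : (map_mx intr B *m wD) k 0 = \sum_(i in H) w i * xr (enum_val k) i -
     \sum_(i in H) (w i - \sum_(d in D) (A i d)%:~R * w d) * xr (enum_val k) i.
    rewrite -sumrB mxE.
    under eq_bigr => l _ do rewrite mxE BE mxE mulr_suml.
    rewrite exchange_big /=; apply: eq_bigr => i _.
    rewrite -mulrBl opprB addrCA subrr addr0 mulr_suml [RHS]big_enum_val.
    by apply: eq_bigr => l _; ring.
  apply: le_trans (ler_normB _ _) _; apply: lerD; first exact/Nb/enum_valP.
  apply: le_trans (ler_norm_sum _ _ _) _.
  apply: (@le_trans _ _ (#|H|%:R * b)); last by rewrite ler_wpM2r.
  rewrite mulr_natl -sumr_const; apply: ler_sum => i iH.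
  by rewrite normrM xr1 mulr1; have [] := AH i iH.
have [[c c0 Bc]|small] := int_kernel_or_small B wD h (b + h * b) h1 Bh Bw.
  left; exists (fun i => if i \in H then \sum_l (A i (enum_val l))%:~R * c l 0 else 0).
  split.
  - have /cV0Pn[l cl] := c0; exists (enum_val l).
    have lD := enum_valP l; rewrite (fintype.subsetP DH) //.
    rewrite (bigD1 l) //= big1 ?addr0 => [|k kl].
      by rewrite AD // eqxx mul1r.
    rewrite AD // (inj_eq enum_val_inj) (negbTE kl) mul0r //.
  - by move=> i /negbTE ->.
  - move=> x xN; move/matrixP/(_ (enum_rank_in xN x) 0): Bc; rewrite !mxE => Bc.
    rewrite -[RHS]Bc /dotp.
    rewrite (eq_bigr (fun i => if i \in H then
       \sum_l (A i (enum_val l))%:~R * c l 0 * xr x i else 0)); last first.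
      by move=> i _; case: ifP => _; rewrite ?mul0r ?mulr_suml.
    rewrite -big_mkcond exchange_big /=; apply: eq_bigr => l _.
    rewrite mxE BE enum_rankK_in // mulr_suml.
    by apply: eq_bigr => i _; ring.
right=> j jH.
set m := r%:R * r`!%:R * h ^+ r * (b + h * b).
have bh0 : 0 <= b + h * b by rewrite addr_ge0 // mulr_ge0 //; lra.
have wm d : d \in D -> `|w d| <= m.
  move=> dD; have := small (enum_rank_in dD d); rewrite mxE enum_rankK_in // => /le_trans; apply.
  rewrite /m ler_wpM2r // ler_pM ?mulr_ge0 ?exprn_ge0 ?ler0n //; try lra.
    by rewrite ler_pM ?ler0n // ler_nat // leq_fact.
  by rewrite ler_weXn2l.
have m0 : 0 <= m by rewrite /m !mulr_ge0 ?exprn_ge0 ?ler0n //; lra.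
have [Aj wj] := AH j jH.
rewrite -[w j](subrK (\sum_(d in D) (A j d)%:~R * w d)) addrC.
apply: le_trans (ler_normD _ _) _; apply: lerD => //.
apply: le_trans (ler_norm_sum _ _ _) _.
apply: (@le_trans _ _ (#|D|%:R * m)); last by rewrite ler_wpM2r // ler_nat.
rewrite mulr_natl -sumr_const; apply: ler_sum => d dD.
rewrite normrM -[leRHS]mul1r ler_pM //; last exact: wm.
by rewrite -intr_norm -[leRHS]/(1%:~R) ler_int.
Qed.

(** * Numerical estimates for the parameters *)

Lemma ler_exp2n {R : realType} (m n : nat) : (m <= n)%N -> 2 ^+ m <= 2 ^+ n :> R.
Proof. by move=> mn; rewrite ler_weXn2l // ler1n. Qed.

Lemma natr_le_exp2 {R : realType} (m n : nat) : (m <= 2 ^ n)%N -> m%:R <= 2 ^+ n :> R.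
Proof. by move=> mn; rewrite -natrX ler_nat. Qed.

(** The two terms will bound the squared norms of the large and of the small coefficients of a unit
    form. Everything is a power of [Q]: [m <= Q ^+ (5 * q + 26) * b], and [b ^+ 2] has exponent
    [- 80 * q], so each term is at most [Q^-1 <= 1/4]. *)
Lemma numeric_gap {R : realType} (q : nat) (Q : R) : (2 <= q)%N -> 4 <= Q ->
  q.+1%:R <= Q ->
  let b : R := (Q ^+ (40 * q))^-1 in
  let b' := b + 6 * Q ^+ 11 * b in let h := 9 * Q ^+ 2 in
  let m := q.+1%:R * (q.+1%:R * q.+1`!%:R * h ^+ q.+1 * (b' + h * b')) + b' in
  is_true (h * m ^+ 2 + 9 * b ^+ 2 * Q ^+ 2 < 1).
Proof.
move=> q2 Q4 rQ b b' h m.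
have Q0 : 0 < Q by lra.
have QX i j : (i <= j)%N -> Q ^+ i <= Q ^+ j by move=> ij; rewrite ler_weXn2l //; lra.
have b2 : b ^+ 2 = (Q ^+ (80 * q))^-1.
  by rewrite /b exprVn -exprM; congr (_ ^+ _)^-1; clear; lia.
have b0 : 0 < b by rewrite invr_gt0 exprn_gt0.
have Q2 : 16 <= Q ^+ 2 by nra.
have hQ : h <= Q ^+ 4 by rewrite /h (_ : (4 = 2 + 2)%N) // exprD; nra.
have h1 : 1 <= h by rewrite /h; nra.
have Q11 : 1 <= Q ^+ 11 by rewrite exprn_ege1 //; lra.
have bQ : b' <= Q ^+ 13 * b.
  rewrite /b' (_ : 13 = 2 + 11)%N // exprD.
  have : 7 * (Q ^+ 11 * b) <= Q ^+ 2 * (Q ^+ 11 * b).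
    by rewrite ler_pM2r ?mulr_gt0 ?exprn_gt0 //; lra.
  have : b <= Q ^+ 11 * b by rewrite ler_peMl // ltW.
  by rewrite !mulrA; lra.
have b'0 : 0 < b' by rewrite /b' addr_gt0 // !mulr_gt0 ?exprn_gt0.
have fQ : q.+1`!%:R <= Q ^+ q.+1.
  apply: (@le_trans _ _ (q.+1%:R ^+ q.+1)); last by rewrite lerXn2r ?nnegrE ?ler0n // ltW.
  rewrite -natrX ler_nat.
  have fact_le k a : (k <= a -> k`! <= a ^ k)%N.
    by elim: k => // k IH ka; rewrite factS expnS leq_mul // IH // ltnW.
  exact: fact_le.
clearbody b.
have mQ : m <= Q ^+ (5 * q + 26) * b.
  have step : q.+1%:R * (q.+1%:R * q.+1`!%:R * h ^+ q.+1 * (b' + h * b')) <=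
     Q * (Q * Q ^+ q.+1 * (Q ^+ 4) ^+ q.+1 * (Q ^+ 5 * (Q ^+ 13 * b))).
    have hb : b' + h * b' <= Q ^+ 5 * (Q ^+ 13 * b).
      rewrite -{1}[b']mul1r -mulrDl.
      apply: ler_pM => //; try lra.
      by rewrite (_ : 5 = 1 + 4)%N // exprD expr1; nra.
    have hq : h ^+ q.+1 <= (Q ^+ 4) ^+ q.+1.
      by rewrite lerXn2r ?nnegrE ?exprn_ge0 //; lra.
    have p0 : 0 <= b' + h * b' by nra.
    have p1 : 0 <= h ^+ q.+1 by rewrite exprn_ge0 //; lra.
    by do !(apply: ler_pM; rewrite ?mulr_ge0 ?ler0n //).
  have -> : Q ^+ (5 * q + 26) * b = Q * (Q ^+ (5 * q + 25) * b).
    by rewrite mulrA -exprS -addnS.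
  have e1 : Q * (Q * Q ^+ q.+1 * (Q ^+ 4) ^+ q.+1 * (Q ^+ 5 * (Q ^+ 13 * b))) =
    Q ^+ (5 * q + 25) * b.
    have -> : (5 * q + 25 = q.+1 + 4 * q.+1 + 20)%N by clear; lia.
    by rewrite !exprD exprM; ring.
  have e2 : b' <= Q ^+ (5 * q + 25) * b.
    by apply: le_trans bQ _; rewrite ler_pM2r // QX //; clear -q2; lia.
  by rewrite /m; move: step; rewrite e1; nra.
have m0 : 0 <= m.
  rewrite /m addr_ge0 ?(ltW b'0) // !mulr_ge0 ?ler0n ?exprn_ge0 //; try lra.
  by nra.
have t1 : h * m ^+ 2 <= Q ^+ (10 * q + 56) * b ^+ 2.
  have -> : Q ^+ (10 * q + 56) * b ^+ 2 = Q ^+ 4 * (Q ^+ (5 * q + 26) * b) ^+ 2.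
    have -> : (10 * q + 56 = 4 + (5 * q + 26) * 2)%N by clear; lia.
    by rewrite exprMn exprD [Q ^+ (_ * 2)]exprM [RHS]mulrA.
  apply: ler_pM; rewrite ?exprn_ge0 //; first lra.
  by rewrite lerXn2r ?nnegrE // mulr_ge0 ?exprn_ge0 // ltW.
have t2 : 9 * b ^+ 2 * Q ^+ 2 <= Q ^+ (10 * q + 56) * b ^+ 2.
  rewrite mulrAC ler_pM2r ?exprn_gt0 //.
  apply: le_trans hQ _; apply: QX; clear -q2; lia.
have t3 : Q ^+ (10 * q + 56) * b ^+ 2 <= Q^-1.
  rewrite b2 ler_pdivrMr ?exprn_gt0 // ler_pdivlMl // -exprS; apply: QX; clear -q2; lia.
have : Q^-1 <= 4^-1 by rewrite lef_pV2 ?posrE.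
by lra.
Qed.

Lemma exp2_le_expR {R : realType} (n : nat) : 2 ^+ n <= expR n%:R :> R.
Proof.
rewrite -[n%:R]mulr1 expRM_natl lerXn2r ?nnegrE ?expR_ge0 //.
by have := expR_ge1Dx (1 : R); lra.
Qed.

(** The exponential of [Q ^+ 10] is at least 2 to the power [2 ^ (10 * q)], whereas the other
    factors are only 2 to a cubic polynomial in [q]; the comparison uses [q ^ 3 <= 8 ^ q]. *)
Lemma numeric_tail {R : realType} (q k : nat) : (2 <= q)%N -> (k <= q)%N ->
  let Q : R := 2 ^+ q in
  is_true (20 * Q ^+ (46 * q * k) * Q ^+ 10 * expR (- Q ^+ 10) <= Q^-1).
Proof.
move=> q2 kq Q.
have Q0 : 0 < Q by rewrite exprn_gt0.
have Q4 : 4 <= Q by rewrite (_ : 4 = 2 ^+ 2) ?ler_exp2n // -natrX.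
rewrite expRN ler_pdivrMr ?expR_gt0 // ler_pdivlMl //.
have QE : Q ^+ 10 = (2 ^ (q * 10))%N%:R by rewrite natrX /Q -exprM.
have := exp2_le_expR (R := R) (2 ^ (q * 10)); rewrite -QE; apply: le_trans.
apply: (@le_trans _ _ (Q ^+ (46 * q * k + 14))).
  rewrite exprD (_ : 14 = 1 + 10 + 3)%N // !exprD expr1.
  have : 20 <= Q ^+ 3.
    have : 16 <= Q ^+ 2 by nra.
    by rewrite [Q ^+ 3]exprS; nra.
  move=> h3; have p : 0 <= Q * Q ^+ (46 * q * k) * Q ^+ 10.
    by rewrite !mulr_ge0 ?exprn_ge0 // ltW.
  nra.
rewrite /Q -exprM ler_exp2n //.
have q3 : (q ^ 3 <= 8 ^ q)%N.
  by rewrite (_ : 8 = 2 ^ 3)%N // -expnM mulnC expnM leq_exp2r // ltnW // ltn_expl.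
apply: (@leq_trans (2 ^ (6 + 3 * q))); last first.
  by rewrite leq_exp2l //; clear -q2; lia.
have -> : (2 ^ (6 + 3 * q) = 64 * 8 ^ q)%N by rewrite expnD expnM.
apply: leq_trans (leq_mul (leqnn 64) q3).
apply: (@leq_trans (q * (46 * q * q + 14))); first by rewrite leq_mul // leq_add // leq_mul.
by clear -q2; rewrite !expnS expn0; nia.
Qed.

(** * An exact linear relation on most near points *)

(** Splitting [w] at level [b], [small_ball] leaves at most [9 * Q ^+ 2] large coefficients and a
    tail [t] of norm at most [3 * b * Q]. Where [t] is small, the large part nearly cancels and
    [vanishing_form_or_small] applies. *)
Lemma vanishing_form_near {R : realType} {n q : nat} (w : 'I_n -> R)
    (N : {set cube n}) : (2 <= q)%N ->
  let Q : R := 2 ^+ q in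
  4 * expR (- Q ^+ 10) <= (2 * Q)^-1 ->
  \sum_i w i ^+ 2 = 1 ->
  Q^-1 * 2 ^+ n <= #|N|%:R ->
  (forall x, x \in N -> `|dotp w x| <= (Q ^+ (40 * q))^-1) ->
  exists (N' : {set cube n}) (v : 'I_n -> R),
    [/\ N' \subset N, #|N :\: N'|%:R <= 4 * expR (- Q ^+ 10) * 2 ^+ n,
      exists j, v j != 0, forall i, w i = 0 -> v i = 0
    & forall x, x \in N' -> dotp v x = 0].
Proof.
move=> q2 Q eQ w1 NQ Nw.
set b : R := (Q ^+ (40 * q))^-1 in Nw.
have Q0 : 0 < Q by rewrite exprn_gt0.
have Q4 : 4 <= Q by rewrite (_ : 4 = 2 ^+ 2) ?ler_exp2n // -natrX.
have b0 : 0 < b by rewrite invr_gt0 exprn_gt0.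
have minw : \sum_i Num.min `|w i| b ^+ 2 <= 9 * b ^+ 2 * Q ^+ 2.
  have := small_ball w b (Q^-1) N b0 _ NQ Nw; rewrite invr_gt0 => /(_ Q0).
  by rewrite (exprVn Q) invrK.
pose H := [set i | b <= `|w i|].
have H9 : #|H|%:R <= 9 * Q ^+ 2.
  rewrite -(ler_pM2r (_ : 0 < b ^+ 2)) ?exprn_gt0 // mulrAC.
  apply: le_trans minw; rewrite mulr_natl -sumr_const [leRHS](bigID (mem H)) /=.
  rewrite -[leLHS]addr0; apply: lerD; last by apply: sumr_ge0 => i _; exact: sqr_ge0.
  by apply: ler_sum => i; rewrite inE => bi; rewrite min_r.
pose t i := if i \in H then 0 else w i.
have t9 : \sum_i t i ^+ 2 <= 9 * b ^+ 2 * Q ^+ 2.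
  apply: le_trans minw; apply: ler_sum => i _; rewrite /t inE.
  case: (leP b `|w i|) => bi; first by rewrite expr0n /= sqr_ge0.
  by rewrite real_normK ?num_real.
have t9' : \sum_i t i ^+ 2 <= (3 * b * Q) ^+ 2 by rewrite !exprMn -natrX.
(* The threshold is [Q ^+ 10] times [2 * (3 * b * Q)], the scale of [exp_tail] for [t]. *)
pose N' := [set x in N | `|dotp t x| < 6 * Q ^+ 11 * b].
have N'N : N' \subset N by apply/fintype.subsetP => x; rewrite inE => /andP[].
have far : #|N :\: N'|%:R <= 4 * expR (- Q ^+ 10) * 2 ^+ n.
  apply: (exp_tail t (3 * b * Q)) => //; first by rewrite !mulr_gt0.
  move=> x; rewrite !inE => /andP[h xN]; move: h; rewrite xN /= -leNgt => h.
  rewrite ler_pdivlMr ?mulr_gt0 //; apply: le_trans h.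
  by rewrite [Q ^+ 11]exprS; lra.
have n0 : 0 < 2 ^+ n :> R by rewrite exprn_gt0.
have N'Q : (2 * Q)^-1 * 2 ^+ n <= #|N'|%:R.
  have : #|N|%:R = #|N'|%:R + #|N :\: N'|%:R :> R.
    by rewrite -natrD -(cardsID N' N) (finset.setIidPr N'N).
  have := ler_wpM2r (ltW n0) eQ.
  have -> : (2 * Q)^-1 = Q^-1 / 2 by rewrite invfM mulrC.
  by move: NQ far; lra.
pose b' := b + 6 * Q ^+ 11 * b.
have N'b x : x \in N' -> `|\sum_(i in H) w i * xr x i| <= b'.
  rewrite inE => /andP[xN tx].
  have -> : \sum_(i in H) w i * xr x i = dotp w x - dotp t x.
    rewrite /dotp -sumrB big_mkcond /=; apply: eq_bigr => i _; rewrite /t.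
    by case: ifP => _; rewrite ?mul0r ?subr0 ?subrr.
  apply: le_trans (ler_normB _ _) _; apply: lerD; first exact: Nw.
  exact: ltW.
have b'0 : 0 <= b' by rewrite /b' addr_ge0 ?mulr_ge0 ?exprn_ge0 // ltW.
(* The density is at least 2 to the power [- (q + 1)]; one more factor 2 makes the inequality
   strict, hence [r = q.+1] below. *)
have Nr : (2 ^ n < #|N'| * 2 ^ q.+2)%N.
  rewrite -(ltr_nat R) natrM !natrX !exprS -/Q.
  have := N'Q; rewrite -(ler_pM2r (_ : 0 < 2 * (2 * Q))) ?mulr_gt0 //.
  have -> : (2 * Q)^-1 * 2 ^+ n * (2 * (2 * Q)) = 2 * 2 ^+ n by field; lra.
  by apply: lt_le_trans; rewrite ltr_pMl // ltr1n.
have h1 : 1 <= 9 * Q ^+ 2 by nra.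
have [[v [vj vH vN]]|small] := vanishing_form_or_small w H N' b' (9 * Q ^+ 2) q.+1
  b'0 h1 H9 Nr N'b.
  exists N', v; split=> // i wi; apply: vH.
  by rewrite inE wi normr0 -ltNge.
have rQ : q.+1%:R <= Q by rewrite /Q natr_le_exp2 // ltn_expl.
(* If all large coefficients were at most [m], the squared norm of [w] would be below 1. *)
exfalso; have := numeric_gap q Q q2 Q4 rQ; rewrite /= -/b -/b'.
set m := (_ + b' : R); apply/negP; rewrite -leNgt -[leLHS]w1.
rewrite (bigID (mem H)) /=; apply: lerD.
  apply: (@le_trans _ _ (\sum_(i in H) m ^+ 2)).
    apply: ler_sum => i iH; rewrite -(real_normK (num_real _)).
    by rewrite lerXn2r ?nnegrE // ?(le_trans _ (small i iH)) // small.
  by rewrite sumr_const -[leLHS]mulr_natl ler_wpM2r //; exact: sqr_ge0.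
apply: le_trans t9; rewrite big_mkcond /=; apply: ler_sum => i _; rewrite /t.
by case: (i \in H); rewrite /= ?expr0n.
Qed.

(** * The hinge-loss certificate *)

Definition hinge {R : realType} {n : nat} (f : cube n -> R) (v : 'I_n -> R) x : R :=
  Num.max 0 (1 - f x * dotp v x).

(* On [X], the coordinates in [D] are linear functions of the other coordinates. *)
Definition determined (R : realType) {n : nat} (X : {set cube n}) (D : {set 'I_n}) :=
  forall w : 'I_n -> R, exists2 w' : 'I_n -> R, forall i, i \in D -> w' i = 0 &
    forall x, x \in X -> dotp w x = dotp w' x.

(** Applied to single coordinates, determination says that a point of [X] is recovered from its
    coordinates outside [D]. *)
Lemma determined_card {R : realType} {n : nat} (X : {set cube n}) (D : {set 'I_n}) :
  determined R X D -> (#|X| * 2 ^ #|D| <= 2 ^ n)%N.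
Proof.
move=> XD; apply: card_agree => x y xX yX xy; apply/ffunP => d.
have [w' w'D w'X] := XD (fun i => (i == d)%:R).
have delta z : dotp (fun i => (i == d)%:R) z = xr z d :> R.
  rewrite /dotp (bigD1 d) //= eqxx mul1r big1 ?addr0 // => i /negbTE ->.
  by rewrite mul0r.
apply: (@xr_inj R); rewrite -!delta !w'X //; apply: eq_bigr => i _.
have [iD|iD] := boolP (i \in D); first by rewrite w'D // !mul0r.
by rewrite /xr xy.
Qed.

(** One pivot of Gaussian elimination: a multiple of [v] cancels coefficient [j], and coefficients
    already eliminated stay zero because [v] avoids [D]. *)
Lemma determinedU1 {R : realType} {n : nat} (X X' : {set cube n}) (D : {set 'I_n})
    (v : 'I_n -> R) j :
  determined R X D -> X' \subset X -> v j != 0 -> (forall i, i \in D -> v i = 0) ->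
  (forall x, x \in X' -> dotp v x = 0) -> determined R X' (j |: D).
Proof.
move=> XD X'X vj vD vX w.
have [w' w'D w'X] := XD w.
exists (fun i => w' i - w' j / v j * v i) => [i|x xX'].
  rewrite !inE => /orP[/eqP ->|iD]; first by rewrite divfK // subrr.
  by rewrite w'D // (vD i) // mulr0 subr0.
rewrite w'X ?(fintype.subsetP X'X) //.
transitivity (dotp w' x - w' j / v j * dotp v x); first by rewrite vX // mulr0 subr0.
by rewrite /dotp mulr_sumr -sumrB; apply: eq_bigr => i _; rewrite mulrBl mulrA.
Qed.

Lemma dotpZ {R : realType} {n : nat} (a : R) (w : 'I_n -> R) x :
  dotp (fun i => a * w i) x = a * dotp w x.
Proof. by rewrite /dotp mulr_sumr; apply: eq_bigr => i _; rewrite mulrA. Qed.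

Lemma dotpD {R : realType} {n : nat} (v w : 'I_n -> R) x :
  dotp (fun i => v i + w i) x = dotp v x + dotp w x.
Proof. by rewrite /dotp -big_split; apply: eq_bigr => i _; rewrite mulrDl. Qed.

Lemma sum_sqrD_le {R : realType} {n : nat} (v w : 'I_n -> R) (M K : R) :
  0 < M -> 0 <= K -> \sum_i v i ^+ 2 <= M ^+ 2 -> \sum_i w i ^+ 2 = 1 ->
  \sum_i (v i + K * w i) ^+ 2 <= (M + K) ^+ 2.
Proof.
move=> M0 K0 vM w1.
have vw : \sum_i 2 * (v i * w i) <= 2 * M.
  apply: (@le_trans _ _ (\sum_i (v i ^+ 2 / M + M * w i ^+ 2))).
    apply: ler_sum => i _; rewrite -subr_ge0.
    have -> : v i ^+ 2 / M + M * w i ^+ 2 - 2 * (v i * w i) = (v i - M * w i) ^+ 2 / M.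
      by field; lra.
    by rewrite divr_ge0 ?sqr_ge0 // ltW.
  rewrite big_split /= -mulr_suml -mulr_sumr w1.
  suff : (\sum_i v i ^+ 2) / M <= M by lra.
  by rewrite ler_pdivrMr // -expr2.
have -> : \sum_i (v i + K * w i) ^+ 2 =
    \sum_i v i ^+ 2 + K * (\sum_i 2 * (v i * w i)) + K ^+ 2 * \sum_i w i ^+ 2.
  rewrite !mulr_sumr -!big_split /=; apply: eq_bigr => i _; ring.
by rewrite w1; nra.
Qed.

Lemma unit_form {R : realType} {n : nat} (w : 'I_n -> R) :
  (exists x, dotp w x != 0) -> exists2 s : R, 0 < s & \sum_i (s * w i) ^+ 2 = 1.
Proof.
case=> x wx; set V := \sum_i w i ^+ 2.
have V0 : 0 < V.
  rewrite lt_neqAle sumr_ge0 ?andbT => [|i _]; last exact: sqr_ge0.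
  apply: contra wx; rewrite eq_sym psumr_eq0 => [/allP w0|i _]; last exact: sqr_ge0.
  rewrite /dotp big1 // => i _.
  by have := w0 i (mem_index_enum _); rewrite /= sqrf_eq0 => /eqP ->; rewrite mul0r.
exists (Num.sqrt V)^-1; first by rewrite invr_gt0 sqrtr_gt0.
under eq_bigr => i _ do rewrite exprMn.
by rewrite -mulr_sumr exprVn sqr_sqrtr ?ltW // mulVf // gt_eqF.
Qed.

(** This is [1 + y <= expR y] at [y = z / (2 * M) - t]; it charges the overshoot of [z] above
    [2 * M * t] to an exponential moment. *)
Lemma subr_le_expR {R : realType} (z M t : R) : 0 < M ->
  z - 2 * M * t <= 2 * M * expR (- t) * expR (z / (2 * M)).
Proof.
move=> M0; rewrite -[leRHS]mulrA -expRD.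
apply: (@le_trans _ _ (2 * M * (1 + (- t + z / (2 * M))))).
  have -> : 2 * M * (1 + (- t + z / (2 * M))) = 2 * M - 2 * M * t + z by field; lra.
  by lra.
by rewrite ler_pM2l ?expR_ge1Dx //; lra.
Qed.

(** Induction on the number [k] of coordinates still to be determined. Each step multiplies the norm
    bound by [Q ^+ (46 * q)] and adds [Q^-1] to the normalized loss. *)
Lemma hinge_certificate {R : realType} {n q : nat} (f : cube n -> R) (w0 : 'I_n -> R)
    (k : nat) (X : {set cube n}) (D : {set 'I_n}) :
  (2 <= q)%N -> (k <= q)%N -> (q <= #|D| + k)%N ->
  (forall x, x \in X -> `|f x| = 1 /\ 0 < f x * dotp w0 x) ->
  determined R X D ->
  exists2 v : 'I_n -> R, \sum_i v i ^+ 2 <= ((2 ^+ q) ^+ (46 * q * k)) ^+ 2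
    & \sum_(x in X) hinge f v x <= k.+1%:R * (2 ^+ q)^-1 * 2 ^+ n.
Proof.
move=> q2; set Q : R := 2 ^+ q.
have Q4 : 4 <= Q by rewrite (_ : 4 = 2 ^+ 2) ?ler_exp2n // -natrX.
have Q0 : 0 < Q by lra.
have n0 : 0 < 2 ^+ n :> R by rewrite exprn_gt0.
have hinge0 x : hinge f (fun=> 0) x = 1.
  by rewrite /hinge /dotp big1 ?mulr0 ?subr0 ?max_r // => i _; rewrite mul0r.
have hinge_ge0 v x : 0 <= hinge f v x by rewrite /hinge le_max lexx.
elim: k X D => [|k IH] X D kq qDk fX XD.
  (* Now [D] has at least [q] elements, so [X] has density at most [Q^-1] and the zero form, of loss
     1 everywhere, is good enough. *)
  exists (fun=> 0); first by rewrite big1 ?exprn_ge0 // ?ltW // => i _; rewrite expr0n.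
  under eq_bigr => x _ do rewrite hinge0.
  rewrite sum_const_set mulr1 mul1r ler_pdivlMl // mulrC /Q -!natrX -natrM ler_nat.
  apply: leq_trans (determined_card X D XD).
  by rewrite leq_mul // leq_pexp2l //; move: qDk; rewrite addn0.
have [->|[x0 x0X]] := set_0Vmem X.
  exists (fun=> 0).
    by rewrite big1 ?exprn_ge0 // ?ltW // => i _; rewrite expr0n.
  by rewrite big_set0 !mulr_ge0 ?invr_ge0 // ltW.
(* Removing [D] from the form ensures that any relation supported on its coefficients determines a
   new coordinate. *)
have [w1 w1D w1X] := XD w0.
have [s s0 sw] : exists2 s : R, 0 < s & \sum_i (s * w1 i) ^+ 2 = 1.
  apply: unit_form; exists x0; rewrite -w1X //.
  have [_] := fX x0 x0X; apply: contraTneq => ->.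
  by rewrite mulr0 ltxx.
pose w i := s * w1 i.
have fw x : x \in X -> f x * dotp w x = `|dotp w x|.
  move=> xX; have [f1] := fX x xX; rewrite w1X // => fw.
  have fw0 : 0 < f x * dotp w x by rewrite /w dotpZ mulrCA mulr_gt0.
  by rewrite -(gtr0_norm fw0) normrM f1 mul1r.
set b : R := (Q ^+ (40 * q))^-1.
have b0 : 0 < b by rewrite invr_gt0 exprn_gt0.
pose N := [set x in X | `|dotp w x| <= b].
have NX : N \subset X by apply/fintype.subsetP => x; rewrite inE => /andP[].
have Nb x : x \in N -> `|dotp w x| <= b by rewrite inE => /andP[].
(* In the sparse case [w / b] has margin at least 1 off [N], and loss at most 1 on [N] because its
   sign is correct. *)
have [Nsmall|Nbig] := ltP (#|N|%:R : R) (Q^-1 * 2 ^+ n).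
  exists (fun i => b^-1 * w i).
    under eq_bigr => i _ do rewrite exprMn.
    rewrite -mulr_sumr sw mulr1 lerXn2r ?nnegrE ?invr_ge0 ?(ltW b0) ?exprn_ge0 ?(ltW Q0) //.
    by rewrite /b invrK ler_weXn2l //; [lra|clear; nia].
  apply: (@le_trans _ _ (\sum_(x in N) 1)).
    rewrite [leRHS]big_mkcond [leLHS]big_mkcond /=; apply: ler_sum => x _; rewrite inE.
    case: ifP => //= xX; rewrite /hinge dotpZ mulrCA fw //.
    case: (leP `|dotp w x| b) => wb; first by rewrite ge_max ler01 gerBl mulr_ge0 // invr_ge0 ltW.
    rewrite ge_max lexx subr_le0 mulrC ler_pdivlMr // mul1r ltW //.
  rewrite sum_const_set mulr1; apply: le_trans (ltW Nsmall) _.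
  by rewrite -mulrA ler_peMl ?mulr_ge0 ?invr_ge0 ?(ltW Q0) ?(ltW n0) // ler1n.
set E := expR (- Q ^+ 10).
have E0 : 0 < E by rewrite expR_gt0.
have tail := numeric_tail (R := R) q k q2 (ltnW kq); rewrite /= -/Q -/E in tail.
set M : R := Q ^+ (46 * q * k) in tail.
have M1 : 1 <= M by rewrite exprn_ege1 //; lra.
have L1 : 1 <= Q ^+ 10 by rewrite exprn_ege1 //; lra.
have ML : 1 <= M * Q ^+ 10 by nra.
have eQ : 4 * E <= (2 * Q)^-1.
  have : 20 * E <= Q^-1.
    by apply: le_trans tail; rewrite ler_pM2r // -mulrA; lra.
  by rewrite invfM; lra.
have [N' [v [N'N NN' [j vj] vw vN']]] := vanishing_form_near w N q2 eQ sw Nbig Nb.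
have wD i : i \in D -> w i = 0 by move=> iD; rewrite /w w1D // mulr0.
have jD : j \notin D by apply: contra vj => jD; rewrite vw // wD.
have N'X := fintype.subset_trans N'N NX.
have det' : determined R N' (j |: D).
  by apply: (determinedU1 X N' D v j) => // i iD; rewrite vw // wD.
have qD' : (q <= #|j |: D| + k)%N by rewrite cardsU1 jD /= add1n addSnnS.
have [v' v'M v'h] := IH N' (j |: D) (ltnW kq) qD'
  (fun x xN => fX x (fintype.subsetP N'X x xN)) det'.
rewrite -/M in v'M.
(* As [K * b = L], off [N] the term [K * w] pays for the margin 1 and for values of [v'] up to
   [2 * M * Q ^+ 10]; larger values are exponentially rare. *)
pose L := 1 + 2 * M * Q ^+ 10; pose K := L / b.
have L0 : 0 < L by rewrite /L; nra.
have K0 : 0 < K by rewrite divr_gt0.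
exists (fun i => v' i + K * w i).
  apply: le_trans (sum_sqrD_le v' w M K _ (ltW K0) v'M sw) _; first by lra.
  (* The step costs [4 * Q ^+ 10 * Q ^+ (40 * q)], at most [Q ^+ (40 * q + 11)]; since [q >= 2],
     exponent [46 * q] suffices. *)
  suff MK : M + K <= Q ^+ (46 * q * k.+1).
    by apply: lerXn2r; rewrite ?nnegrE ?exprn_ge0 ?(ltW Q0) //; lra.
  rewrite /K /b invrK.
  have p40 : 1 <= Q ^+ (40 * q) by rewrite exprn_ege1 //; lra.
  apply: (@le_trans _ _ (4 * M * Q ^+ 10 * Q ^+ (40 * q))).
    have ML' : M <= M * Q ^+ 10 by rewrite ler_peMr //; lra.
    have : M + L <= 4 * M * Q ^+ 10 by rewrite /L -!mulrA; lra.
    move=> /(ler_wpM2r (ltW (lt_le_trans ltr01 p40))) h; apply: le_trans h.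
    by rewrite [leRHS]mulrDl lerD2r ler_peMr //; lra.
  apply: (@le_trans _ _ (M * Q ^+ (11 + 40 * q))).
    have p : 0 <= M * Q ^+ 10 * Q ^+ (40 * q).
      by apply: mulr_ge0; [lra|rewrite exprn_ge0 // ltW].
    have := ler_wpM2r p Q4; rewrite exprD [Q ^+ 11]exprS.
    by move: (Q ^+ 10) (Q ^+ (40 * q)) => Q1 Q2; lra.
  rewrite /M -exprD ler_weXn2l //; first lra.
  by rewrite mulnS addnC leq_add2r; clear -q2; lia.
have dotE x : dotp (fun i => v' i + K * w i) x = dotp v' x + K * dotp w x.
  by rewrite dotpD dotpZ.
have hE x : x \in X -> hinge f (fun i => v' i + K * w i) x =
    Num.max 0 (1 - f x * dotp v' x - K * `|dotp w x|).
  by move=> xX; rewrite /hinge dotE mulrDr (mulrCA _ K) fw // opprD addrA.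
(* On [N'] adding [K * w] cannot hurt, its sign being correct. On the rest of [N] the loss is at
   most [L] plus the overshoot of [v'], and off [N] only the overshoot remains. *)
have bound x : x \in X -> hinge f (fun i => v' i + K * w i) x <=
    (if x \in N' then hinge f v' x else 0) +
    (2 * M * E * expR (`|dotp v' x| / (2 * M)) + (if x \in N :\: N' then L else 0)).
  move=> xX; rewrite hE //.
  have M2 : 0 < 2 * M by lra.
  have e0 : 0 <= 2 * M * E * expR (`|dotp v' x| / (2 * M)).
    by apply: mulr_ge0; rewrite ?expR_ge0 // mulr_ge0 // ltW.
  have Kw : 0 <= K * `|dotp w x| by rewrite mulr_ge0 // ltW.
  have key : 1 + `|dotp v' x| - L <= 2 * M * E * expR (`|dotp v' x| / (2 * M)).
    by rewrite /L opprD addrACA subrr add0r; apply: subr_le_expR; lra.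
  have fv : - (f x * dotp v' x) <= `|dotp v' x|.
    have [f1 _] := fX x xX.
    by have := ler_norm (- (f x * dotp v' x)); rewrite normrN normrM f1 mul1r.
  have [xN'|xN'] := boolP (x \in N').
    rewrite inE xN' /= addr0; apply: le_trans (_ : hinge f v' x <= _); last by rewrite lerDl.
    by rewrite /hinge ge_max !le_max lexx /=; apply/orP; right; lra.
  rewrite inE xN' /= add0r ge_max; case: ifP => xN.
    by apply/andP; split; lra.
  rewrite addr0 e0 /=; apply: le_trans key.
  have : L <= K * `|dotp w x|.
    move: xN; rewrite inE xX /= => /negbT; rewrite -ltNge => /ltW bw.
    by rewrite /K mulrAC ler_pdivlMr // ler_pM2l.
  by lra.
apply: le_trans; first by apply: ler_sum => x xX; exact: bound.
rewrite !big_split /=.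
have s1 : \sum_(x in X) (if x \in N' then hinge f v' x else 0) <=
    k.+1%:R * Q^-1 * 2 ^+ n.
  apply: le_trans v'h; rewrite big_mkcond [leRHS]big_mkcond /=; apply: ler_sum => x _.
  by case: ifP => // _; case: ifP.
have s2 : \sum_(x in X) 2 * M * E * expR (`|dotp v' x| / (2 * M)) <=
    8 * M * E * 2 ^+ n.
  rewrite -mulr_sumr.
  have : \sum_(x in X) expR (`|dotp v' x| / (2 * M)) <= 4 * 2 ^+ n.
    apply: le_trans (exp_moment v' M _ v'M); last lra.
    rewrite big_mkcond /=; apply: ler_sum => x _.
    by case: ifP => // _; exact: expR_ge0.
  move=> /(ler_wpM2l (_ : 0 <= 2 * M * E)) => h; apply: le_trans (h _) _.
    by rewrite !mulr_ge0 //; lra.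
  by lra.
have s3 : \sum_(x in X) (if x \in N :\: N' then L else 0) <= 4 * L * E * 2 ^+ n.
  apply: (@le_trans _ _ (#|N :\: N'|%:R * L)).
    rewrite -sum_const_set big_mkcond [leRHS]big_mkcond /=; apply: ler_sum => x _.
    by case: ifP => // _; case: ifP => // _; exact: ltW.
  rewrite mulrC; move: NN' => /(ler_wpM2l (ltW L0)); rewrite -/E => h.
  by apply: le_trans h _; lra.
(* Since [L <= 3 * M * Q ^+ 10], the two terms make up the constant 20 of [numeric_tail]. *)
have s4 : 8 * M * E + 4 * L * E <= Q^-1.
  apply: le_trans tail; rewrite -mulrDl ler_wpM2r ?(ltW E0) // /L; nra.
have := ler_wpM2r (ltW n0) s4.
rewrite -[k.+2%:R]natr1.
by lra.
Qed.

(** * From the certificate to the Chow distance *)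

(** The extra coordinate, fixed to [true], absorbs the threshold into a linear form. *)
Definition homogenize {n : nat} (x : cube n) : cube n.+1 :=
  [ffun i => if unlift ord0 i is Some j then x j else true].

Lemma homogenize_inj {n : nat} : injective (@homogenize n).
Proof.
move=> x y /ffunP xy; apply/ffunP => i.
by have := xy (lift ord0 i); rewrite !ffunE liftK.
Qed.

Lemma dotp_homogenize {R : realType} {n : nat} (v : 'I_n.+1 -> R) (x : cube n) :
  dotp v (homogenize x) = v ord0 + \sum_(i < n) v (lift ord0 i) * xr x i.
Proof.
rewrite /dotp big_ord_recl /xr ffunE unlift_none mulr1; congr (_ + _).
by apply: eq_bigr => i _; rewrite ffunE liftK.
Qed.

(** Only the value 0 lacks strictness, and it counts as positive. The cube being finite, negative
    values stay below some [- eta], so adding [eta] to the form keeps every sign and removes the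
    zeros. *)
Lemma strict_threshold {R : realType} {n : nat} (f : cube n -> R) : is_LTF f ->
  exists w : 'I_n.+1 -> R, forall x, `|f x| = 1 /\ 0 < f x * dotp w (homogenize x).
Proof.
case=> w [theta fE].
have [eta eta0 etaP] : exists2 eta : R, 0 < eta &
    forall x, x \in enum (cube n) -> \sum_(i < n) w i * xr x i - theta < 0 ->
      \sum_(i < n) w i * xr x i - theta + eta < 0.
  elim: (enum _) => [|x s [eta eta0 IH]]; first by exists 1.
  have [x0|x0] := ltP (\sum_(i < n) w i * xr x i - theta) 0.
    set z := _ - theta in x0.
    exists (Num.min eta (- z / 2)) => [|y].
      by rewrite lt_min eta0 /= divr_gt0 // oppr_gt0.
    rewrite inE => /orP[/eqP -> _|ys y0].
      rewrite -/z; apply: (@le_lt_trans _ _ (z + - z / 2)); last by lra.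
      by rewrite lerD2l ge_min lexx orbT.
    apply: le_lt_trans (IH y ys y0).
    by rewrite lerD2l ge_min lexx.
  exists eta => // y; rewrite inE => /orP[/eqP -> y0|]; last exact: IH.
  by move: x0; rewrite leNgt y0.
exists (fun i => if unlift ord0 i is Some j then w j else eta - theta) => x.
rewrite dotp_homogenize unlift_none.
under eq_bigr => i _ do rewrite liftK.
rewrite fE /sgn; have := etaP x (mem_enum _ _).
set z := \sum_(i < n) _; case: leP => z0 h.
  by rewrite normr1; split=> //; lra.
by rewrite normrN1; split=> //; have := h isT; lra.
Qed.

Lemma norm1_or {R : realType} {a : R} : `|a| = 1 -> a = 1 \/ a = -1.
Proof. by move=> /eqP; rewrite eqr_norml ler01 andbT => /orP[]/eqP; [left|right]. Qed.

Lemma dist_le_hinge {R : realType} {n : nat} (f g : cube n -> R) (v : 'I_n.+1 -> R)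
    (M eps : R) : 0 < M -> 0 < eps ->
  (forall x, `|f x| = 1) -> (forall x, -1 <= g x <= 1) ->
  \sum_i v i ^+ 2 <= M ^+ 2 -> d_Chow f g <= eps ->
  dist f g <= M * eps + 2 * Ex (fun x => Num.max 0 (1 - f x * dotp v (homogenize x))).
Proof.
move=> M0 e0 f1 g1 vM fg.
have n0 : 0 < 2 ^+ n :> R by rewrite exprn_gt0.
pose c0 := chow0 f - chow0 g; pose c i := chowi f i - chowi g i.
have ce : c0 ^+ 2 + \sum_i c i ^+ 2 <= eps ^+ 2.
  have s0 : 0 <= c0 ^+ 2 + \sum_i c i ^+ 2.
    by rewrite addr_ge0 ?sqr_ge0 // sumr_ge0 // => i _; exact: sqr_ge0.
  by rewrite -(sqr_sqrtr s0) lerXn2r ?nnegrE ?sqrtr_ge0 // ltW.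
have corr : Ex (fun x => (f x - g x) * dotp v (homogenize x)) =
    v ord0 * c0 + \sum_i v (lift ord0 i) * c i.
  rewrite /Ex /c0 /c /chow0 /chowi /Ex.
  rewrite -mulrBl -sumrB mulrA mulr_sumr.
  under [X in _ + X]eq_bigr => i _ do rewrite -mulrBl -sumrB mulrA mulr_sumr.
  rewrite -mulr_suml -mulrDl exchange_big /= -big_split /=; congr (_ / _).
  apply: eq_bigr => x _; rewrite dotp_homogenize mulrDr mulrC; congr (_ + _).
  by rewrite mulr_sumr; apply: eq_bigr => i _; ring.
have corr_le : Ex (fun x => (f x - g x) * dotp v (homogenize x)) <= M * eps.
  (* Cauchy-Schwarz through AM-GM, with weights making both halves equal to [M * eps / 2] at the
     extreme norms. *)
  have amgm a b : a * b <= eps / (2 * M) * a ^+ 2 + M / (2 * eps) * b ^+ 2.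
    rewrite -subr_ge0.
    have -> : eps / (2 * M) * a ^+ 2 + M / (2 * eps) * b ^+ 2 - a * b =
      (eps * a - M * b) ^+ 2 / (2 * M * eps) by field; rewrite !gt_eqF.
    by rewrite divr_ge0 ?sqr_ge0 // !mulr_ge0 // ltW.
  rewrite corr; clear corr; clearbody c0 c; apply: (@le_trans _ _ (eps / (2 * M) * \sum_i v i ^+ 2 +
     M / (2 * eps) * (c0 ^+ 2 + \sum_i c i ^+ 2))).
    rewrite big_ord_recl !mulrDr addrACA !mulr_sumr -big_split /=.
    by apply: lerD; [exact: amgm|apply: ler_sum => i _; exact: amgm].
  have -> : M * eps = eps / (2 * M) * M ^+ 2 + M / (2 * eps) * eps ^+ 2.
    by field; rewrite !gt_eqF.
  by apply: lerD; rewrite ler_pM2l // divr_gt0 // mulr_gt0.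
apply: le_trans (_ : _ <= Ex (fun x => (f x - g x) * dotp v (homogenize x)) +
   2 * Ex (fun x => Num.max 0 (1 - f x * dotp v (homogenize x)))) _; last first.
  by rewrite lerD2r.
rewrite /dist /Ex mulrA -mulrDl ler_pM2r ?invr_gt0 // mulr_sumr -big_split /=.
apply: ler_sum => x _; set l := dotp v _.
have m0 : 0 <= Num.max 0 (1 - f x * l) by rewrite le_max lexx.
have m1 : 1 - f x * l <= Num.max 0 (1 - f x * l) by rewrite le_max lexx orbT.
have /andP[gl gu] := g1 x.
(* With [u = f x - g x], the product [u * f x = |u|] lies in [[0, 2]], and
   [|u| - u * l = u * f x * (1 - f x * l)]. *)
have [fx|fx] := norm1_or (f1 x).
  rewrite fx ger0_norm ?subr_ge0 // in m0 m1 *; nra.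
rewrite fx ler0_norm in m0 m1 *; [nra|lra].
Qed.

Lemma chow_distance_bound {R : realType} {n q : nat} (f g : cube n -> R) (eps : R) :
  (2 <= q)%N -> is_LTF f -> (forall x, -1 <= g x <= 1) -> 0 < eps ->
  d_Chow f g <= eps ->
  dist f g <= (2 ^+ q) ^+ (46 * q * q) * eps + 4 * q.+1%:R / 2 ^+ q.
Proof.
move=> q2 fLTF g1 e0 fg.
have [w fw] := strict_threshold f fLTF.
(* An extension of [f] to the larger cube; only its values on the image [X] matter. *)
pose f' (y : cube n.+1) : R := sgn (dotp w y).
have f'E x : f' (homogenize x) = f x.
  rewrite /f' /sgn; have [] := fw x.
  case/norm1_or => fx.
    by rewrite fx mul1r => /ltW ->.
  by rewrite fx mulN1r oppr_gt0 leNgt => ->.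
pose X := [set homogenize x | x in [set: cube n]].
have f'X y : y \in X -> `|f' y| = 1 /\ 0 < f' y * dotp w y.
  by case/imsetP => x _ ->; rewrite f'E.
have X0 : determined R X finset.set0.
  by move=> w'; exists w' => // i; rewrite inE.
have q0 : (q <= #|@finset.set0 'I_n.+1| + q)%N by rewrite cards0.
have [v vM vh] := hinge_certificate f' w q X finset.set0 q2 (leqnn q) q0 f'X X0.
have M0 : 0 < (2 ^+ q) ^+ (46 * q * q) :> R by rewrite !exprn_gt0.
apply: le_trans (dist_le_hinge f g v _ eps M0 e0 (fun x => (fw x).1) g1 vM fg) _.
rewrite lerD2l /Ex mulrA ler_pdivrMr ?exprn_gt0 //.
have := ler_wpM2l (ler0n R 2) vh.
rewrite big_imset /=; last by move=> x y _ _; exact: homogenize_inj.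
rewrite (eq_bigl xpredT) => [|x]; last by rewrite inE.
under eq_bigr => x _ do rewrite /hinge f'E.
(* The larger cube has [2 ^ n.+1] points, which turns the factor 2 into 4. *)
move=> h; apply: le_trans h _; rewrite exprS.
by lra.
Qed.

(** * Choice of the number of steps and final rate *)

(** With [q = 2 * p] the norm bound is 2 to the power [368 * p ^ 3], beaten by [eps], which is at
    most 2 to the power [- 512 * p ^ 3]. Half of the gain [2 ^ (2 * p)] then absorbs the linear
    factor, as [8 * p + 5 <= 2 ^ p] from [p = 6] on. *)
Lemma quasipoly_rate {R : realType} (p : nat) (eps t : R) : (6 <= p)%N ->
  8 * p%:R <= t -> eps <= expR (- t ^+ 3) ->
  (2 ^+ (2 * p)) ^+ (46 * (2 * p) * (2 * p)) * eps +
    4 * (2 * p).+1%:R / 2 ^+ (2 * p) <= (2 ^+ p)^-1.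
Proof.
move=> p6 pt et.
have P0 : 0 < 2 ^+ p :> R by rewrite exprn_gt0.
have e1 : eps <= (2 ^+ (512 * (p * p * p)))^-1.
  apply: le_trans et _; rewrite expRN lef_pV2 ?posrE ?expR_gt0 ?exprn_gt0 //.
  apply: le_trans (exp2_le_expR _) _; rewrite ler_expR.
  apply: le_trans (_ : (8 * p%:R) ^+ 3 <= _); last first.
    by rewrite lerXn2r ?nnegrE // ?(le_trans _ pt) // mulr_ge0.
  by rewrite !natrM; lra.
have e2 : (2 ^+ (2 * p)) ^+ (46 * (2 * p) * (2 * p)) * eps <= (2 ^+ (2 * p))^-1.
  apply: le_trans (ler_wpM2l _ e1) _; first by rewrite !exprn_ge0.
  rewrite ler_pdivrMr ?exprn_gt0 // ler_pdivlMl ?exprn_gt0 // -exprS -exprM.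
  rewrite ler_exp2n //; clear -p6; nia.
have p2 : (8 * p + 5 <= 2 ^ p)%N.
  elim: p p6 {pt P0 e1 e2} => // p IH; rewrite leq_eqVlt => /orP[/eqP <- //|].
  by rewrite ltnS => p6; have := IH p6; rewrite expnS; move: (2 ^ p)%N => z; lia.
have p3 : 8 * p%:R + 5 <= 2 ^+ p :> R.
  by have := natr_le_exp2 (R := R) _ _ p2; rewrite natrD natrM.
apply: (@le_trans _ _ ((8 * p%:R + 5) / 2 ^+ (2 * p))).
  rewrite -[(2 * p).+1%:R]natr1 natrM; move: e2; set x := _^-1; lra.
rewrite ler_pdivrMr ?exprn_gt0 // mul2n -addnn exprD mulrA mulVf ?mul1r //.
Qed.

Theorem theorem7 (R : realType) :
  exists (c : R) (eps0 : R), 0 < c /\ 0 < eps0 /\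
    forall (n : nat) (f g : cube n -> R) (eps : R),
      is_LTF f ->
      (forall x, -1 <= g x <= 1) ->
      0 < eps -> eps <= eps0 ->
      d_Chow f g <= eps ->
      dist f g <= (2 : R) `^ (- (c * (ln (1 / eps)) `^ (3^-1))).
Proof.
(* The bound on [eps] forces [t >= 48], so that [p], the integer part of [t / 8], is at least 6;
   then [t / 16 < (p + 1) / 2 <= p] gives the constant. *)
exists (16^-1), (expR (- 48 ^+ 3)); split; first by rewrite invr_gt0.
split; first exact: expR_gt0.
move=> n f g eps fLTF g1 e0 ee fg.
set t := _ `^ 3^-1.
have L48 : 48 ^+ 3 <= ln (1 / eps).
  rewrite -ler_expR lnK ?posrE ?divr_gt0 // div1r.
  by rewrite -[leLHS]invrK -expRN lef_pV2 ?posrE ?expR_gt0.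
have L0 : 0 <= ln (1 / eps) by apply: le_trans L48; rewrite exprn_ge0.
have t0 : 0 <= t by exact: powR_ge0.
have t3 : t ^+ 3 = ln (1 / eps).
  by rewrite /t -powR_mulrn ?powR_ge0 // -powRrM mulVf // powRr1.
have t48 : 48 <= t.
  rewrite leNgt; apply/negP => t48; move: L48; rewrite -t3 leNgt.
  by rewrite ltrXn2r.
have et : eps <= expR (- t ^+ 3).
  by rewrite t3 expRN lnK ?posrE ?divr_gt0 // div1r invrK.
clearbody t.
have t8 : 0 <= t / 8 by rewrite divr_ge0.
pose p := Num.truncn (t / 8).
have /andP[pl pu] := truncn_itv t8; rewrite -/p in pl pu.
have p6 : (6 <= p)%N.
  rewrite -ltnS -(ltr_nat R); apply: le_lt_trans pu; lra.
have pt : 8 * p%:R <= t by lra.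
apply: le_trans (chow_distance_bound (q := 2 * p) f g eps _ fLTF g1 e0 fg) _.
  by rewrite leq_pmulr // (leq_trans _ p6).
apply: le_trans (quasipoly_rate p eps t p6 pt et) _.
rewrite -powR_mulrn // -powRN ler_powR ?ler1n // lerN2.
have : 6 <= p%:R :> R by rewrite ler_nat.
by move: pu; rewrite -[p.+1%:R]natr1; lra.
Qed.
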